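(* Let $(B,\Delta,\epsilon)$ be a scaled bialgebra over $K$. Then the induced hierarchy $\mathfrak H(B)$, i.e. the ascending algebra $(B_n)_{n\ge 0}$ with $B_n=B^{\otimes n}$ together with the induced matrix action of $\mathcal M(K)$, is a $K$-hierarchy.
   Context: $K$ is a field of characteristic zero. All $K$-algebras are commutative and unital; all bialgebras are commutative and cocommutative. Matrices. $\mathcal M(K)$ is the monoid of infinite matrices (rows and columns indexed by $1,2,3,\dots$) of the form $I+\tilde M$ where $\tilde M$ has only finitely many nonzero rows and columns. A matrix $M\in\mathcal M_n(K)=K^{n\times n}$ is identified with the block matrix $\mathrm{diag}(M,I)\in\mathcal M(K)$. $E_n:=I-e_{nn}$ (with $e_{ij}$ the matrix units). For $M\in\mathcal M(K)$, the $n$-th cut-off $M_{\lrcorner n}$ is the matrix whose first $n$ rows are those of $M$ and whose further rows are the unit rows $e_{n+1},e_{n+2},\dots$. $K$-hierarchy. An ascending algebra is a sequence of $K$-algebras $\mathcal F_0\subseteq\mathcal F_1\subseteq\cdots$ with $\mathcal F_0=K$; its direct limit is $\mathcal F=\bigcup_n\mathcal F_n$. It is a $K$-hierarchy if there is a contravariant monoid action of $\mathcal M(K)$ on $\mathcal F$ by $K$-algebra endomorphisms $M^*:\mathcal F\to\mathcal F$ (so $I^*=\mathrm{id}$, $(M\tilde M)^*=\tilde M^*M^*$) which is straight, i.e. $M^*f=M_{\lrcorner n}^*f$ for all $M\in\mathcal M(K)$, $f\in\mathcal F_n$, and which satisfies $M^*(\mathcal F_n)\subseteq\mathcal F_n$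 for all $M\in\mathcal M_n(K)$ and $E_n^*(\mathcal F_n)\subseteq\mathcal F_{n-1}$. Scaled bialgebra. Let $(B,\Delta,\epsilon)$ be a $K$-bialgebra with product $\nabla$ and unit $1$, and put $\mathsf e:=1\circ\epsilon:B\to B$. For linear endomorphisms $f,g$ of $B$ let $f\oplus g:=\nabla(f\otimes g)\Delta$ be their convolution. A scaling is a monoid homomorphism $\lambda\mapsto\lambda^*$ from $(K\setminus\{0\},\cdot)$ to the bialgebra endomorphisms of $B$ under composition such that, after setting $0^*:=\mathsf e$, the map $\lambda\mapsto\lambda^*$ is a semiring homomorphism from $(K,+,\cdot)$ to the bialgebra endomorphisms with operations $(\oplus,\circ)$; in particular $(\lambda+\mu)^*=\lambda^*\oplus\mu^*$ and $(\lambda\mu)^*=\lambda^*\circ\mu^*$ for all $\lambda,\mu\in K$. A scaled bialgebra is a bialgebra with a scaling. Induced hierarchy. $B_0=K$, $B_n=B^{\otimes n}$, with $B_n$ embedded in $B_{n+1}$ by $f\mapsto f\otimes 1$; $\mathfrak H(B)$ is the direct limit. Iterated coproducts are $\Delta^1=\mathrm{id}_B$, $\Delta^{n+1}=(\Delta^n\otimes\mathrm{id}_B)\Delta$. For a row $a=(a_1,\dots,a_n)\in K^n$ put $a^*:=(a_1^*\otimes\cdots\otimes a_n^* )\,\Delta^n:B\to B_n$. For $M\in\mathcal M_n(K)$ with rows $M_{1\bullet},\dots,M_{n\bullet}$ the induced action on $B_n$ is $M^*(f_1\otimes\cdots\otimes f_n):=(M_{1\bullet}^*f_1)\cdots(M_{n\bullet}^*f_n)$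 (product in $B_n$), extended linearly. Given $M\in\mathcal M(K)$ and $f\in\mathfrak H(B)$ one chooses $n$ large enough that $M\in\mathcal M_n(K)$ and $f\in B_n$, and acts there. *)

(* Defs.v *)
From HB Require Import structures.
From mathcomp Require Import all_boot all_order all_algebra generic_quotient.
From mathcomp Require Import boolp classical_sets cardinality fsbigop.

Set Implicit Arguments.
Unset Strict Implicit.
Unset Printing Implicit Defensive.

Import GRing.Theory.

Local Open Scope ring_scope.
Local Open Scope quotient_scope.
Local Open Scope classical_set_scope.

Section TensorProduct.
Variables (K : fieldType) (U V : lmodType K).

(* Formal sums of pairs (u, v), scalars being absorbed in u, are identified
   when no bilinear map out of U x V distinguishes them: the quotient has the
   universal property of the tensor product, see tens_lift below. *)
Definition tens_eq : rel (seq (U * V)) := fun s t =>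
  `[< forall (W : lmodType K) (b : U -> V -> W), bilinear_for *:%R *:%R b ->
      \sum_(p <- s) b p.1 p.2 = \sum_(p <- t) b p.1 p.2 >].

Lemma tens_eq_refl : reflexive tens_eq.
Proof. by move=> s; apply/asboolP. Qed.

Lemma tens_eq_sym : symmetric tens_eq.
Proof.
by move=> s t; apply/asboolP/asboolP => st W b bb; rewrite st.
Qed.

Lemma tens_eq_trans : transitive tens_eq.
Proof.
move=> t s r /asboolP st /asboolP tr; apply/asboolP => W b bb.
by rewrite st ?tr.
Qed.

Canonical tens_equiv :=
  EquivRel tens_eq tens_eq_refl tens_eq_sym tens_eq_trans.

Definition tens := {eq_quot tens_eq}.
HB.instance Definition _ := Choice.on tens.
HB.instance Definition _ := EqQuotient.on tens.

Definition tens_pure (u : U) (v : V) : tens := \pi_tens [:: (u, v)].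

(* The linear map induced by a bilinear map b (meaningless otherwise). *)
Definition tens_lift (W : lmodType K) (b : U -> V -> W) (x : tens) : W :=
  \sum_(p <- repr x) b p.1 p.2.

Lemma tens_lift_pi (W : lmodType K) (b : U -> V -> W) (s : seq (U * V)) :
  bilinear_for *:%R *:%R b ->
  tens_lift b (\pi_tens s) = \sum_(p <- s) b p.1 p.2.
Proof.
move=> bb; have /asboolP : tens_eq (repr (\pi_tens s)) s.
  by apply/eqmodP; rewrite reprK.
by apply.
Qed.

Lemma tens_ext (x y : tens) :
  (forall (W : lmodType K) (b : U -> V -> W), bilinear_for *:%R *:%R b ->
     tens_lift b x = tens_lift b y) -> x = y.
Proof.
move=> xy; rewrite -[x]reprK -[y]reprK; apply/eqmodP/asboolP => W b bb.
exact: xy.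
Qed.

Definition tens_add (x y : tens) : tens := \pi_tens (repr x ++ repr y).
Definition tens_opp (x : tens) : tens :=
  \pi_tens [seq (- p.1, p.2) | p <- repr x].
Definition tens_scale (a : K) (x : tens) : tens :=
  \pi_tens [seq (a *: p.1, p.2) | p <- repr x].

Section Eval.
Variables (W : lmodType K) (b : U -> V -> W).
Hypothesis bb : bilinear_for *:%R *:%R b.

Let b0l v : b 0 v = 0.
Proof. by have := bb.1 v (-1) 0 0; rewrite /= scaler0 addr0 scaleN1r addNr. Qed.

Let bZl a u v : b (a *: u) v = a *: b u v.
Proof. by have := bb.1 v a u 0; rewrite /= !addr0 b0l addr0. Qed.

Let bNl u v : b (- u) v = - b u v.
Proof. by rewrite -scaleN1r bZl scaleN1r. Qed.

Lemma ev_add x y : tens_lift b (tens_add x y) = tens_lift b x + tens_lift b y.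
Proof. by rewrite tens_lift_pi // big_cat. Qed.

Lemma ev_zero : tens_lift b (\pi_tens [::]) = 0.
Proof. by rewrite tens_lift_pi // big_nil. Qed.

Lemma ev_opp x : tens_lift b (tens_opp x) = - tens_lift b x.
Proof.
by rewrite tens_lift_pi // big_map -sumrN; apply: eq_bigr => p _; rewrite bNl.
Qed.

Lemma ev_scale a x : tens_lift b (tens_scale a x) = a *: tens_lift b x.
Proof.
rewrite tens_lift_pi // big_map scaler_sumr.
by apply: eq_bigr => p _; rewrite bZl.
Qed.

End Eval.

Let tens_addA : associative tens_add.
Proof. by move=> x y z; apply: tens_ext => W b bb; rewrite !ev_add // addrA. Qed.

Let tens_addC : commutative tens_add.
Proof. by move=> x y; apply: tens_ext => W b bb; rewrite !ev_add // addrC. Qed.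

Let tens_add0 : left_id (\pi_tens [::]) tens_add.
Proof.
by move=> x; apply: tens_ext => W b bb; rewrite ev_add // ev_zero // add0r.
Qed.

Let tens_addN : left_inverse (\pi_tens [::]) tens_opp tens_add.
Proof.
move=> x; apply: tens_ext => W b bb.
by rewrite ev_add // ev_opp // ev_zero // addNr.
Qed.

HB.instance Definition _ :=
  GRing.isZmodule.Build tens tens_addA tens_addC tens_add0 tens_addN.

Let tens_scaleA a b x : tens_scale a (tens_scale b x) = tens_scale (a * b) x.
Proof. by apply: tens_ext => W f bf; rewrite !ev_scale // scalerA. Qed.

Let tens_scale1 : left_id 1 tens_scale.
Proof. by move=> x; apply: tens_ext => W f bf; rewrite ev_scale // scale1r. Qed.

Let tens_scaleDr : right_distributive tens_scale +%R.
Proof.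
move=> a x y; apply: tens_ext => W f bf.
by rewrite [x + y]/(tens_add x y) !(ev_scale, ev_add) // scalerDr.
Qed.

Let tens_scaleDl x : {morph tens_scale^~ x : a b / a + b}.
Proof.
move=> a b; apply: tens_ext => W f bf.
by rewrite [_ + tens_scale b x]/(tens_add _ _) !(ev_scale, ev_add) // scalerDl.
Qed.

HB.instance Definition _ := GRing.Zmodule_isLmodule.Build K tens
  tens_scaleA tens_scale1 tens_scaleDr tens_scaleDl.

Lemma tens_lift_linear (W : lmodType K) (b : U -> V -> W) :
  bilinear_for *:%R *:%R b -> linear (tens_lift b).
Proof.
move=> bb a x y.
by rewrite [_ + y]/(tens_add (tens_scale a x) y) ev_add // ev_scale.
Qed.

Lemma tens_lift_pure (W : lmodType K) (b : U -> V -> W) u v :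
  bilinear_for *:%R *:%R b -> tens_lift b (tens_pure u v) = b u v.
Proof. by move=> bb; rewrite tens_lift_pi // big_seq1. Qed.

Lemma tens_pure_bilinear : bilinear_for *:%R *:%R tens_pure.
Proof.
split=> [v|u] a x y; apply: tens_ext => W b bb;
  rewrite [in RHS]tens_lift_linear // !tens_lift_pure //.
- exact: bb.1.
- exact: bb.2.
Qed.

Lemma tens_pureZl (a : K) (u : U) (v : V) :
  tens_pure (a *: u) v = a *: tens_pure u v.
Proof.
have P0 : tens_pure 0 v = 0.
  have := tens_pure_bilinear.1 v (-1) 0 0.
  by rewrite /= scaler0 addr0 scaleN1r addNr.
by have := tens_pure_bilinear.1 v a u 0; rewrite /= addr0 P0 addr0.
Qed.

Lemma tens_pureZr (a : K) (u : U) (v : V) :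
  tens_pure u (a *: v) = a *: tens_pure u v.
Proof.
have P0 : tens_pure u 0 = 0.
  have := tens_pure_bilinear.2 u (-1) 0 0.
  by rewrite /= scaler0 addr0 scaleN1r addNr.
by have := tens_pure_bilinear.2 u a v 0; rewrite /= addr0 P0 addr0.
Qed.

Lemma tens_sum_pure (x : tens) :
  x = \sum_(p <- repr x) tens_pure p.1 p.2.
Proof.
rewrite -[LHS]reprK; elim: (repr x) => [|[u v] s IHs]; first by rewrite big_nil.
rewrite big_cons -IHs; apply: tens_ext => W b bb.
rewrite [_ + _]/(tens_add _ _) ev_add // tens_lift_pure // !tens_lift_pi //.
by rewrite big_cons.
Qed.

Lemma tens_lift_unique (W : lmodType K) (f g : tens -> W) :
  linear f -> linear g ->
  (forall u v, f (tens_pure u v) = g (tens_pure u v)) -> f =1 g.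
Proof.
move=> lf lg fg x.
pose mf := GRing.isLinear.Build _ _ _ _ f lf.
pose mg := GRing.isLinear.Build _ _ _ _ g lg.
pose f' : {linear tens -> W} := HB.pack f mf.
pose g' : {linear tens -> W} := HB.pack g mg.
rewrite -[f]/(f' : _ -> _) -[g]/(g' : _ -> _) (tens_sum_pure x) !linear_sum.
by apply: eq_bigr => p _; exact: fg.
Qed.

Lemma tens_ind (P : tens -> Prop) :
  P 0 -> (forall x y, P x -> P y -> P (x + y)) ->
  (forall u v, P (tens_pure u v)) -> forall x, P x.
Proof.
move=> P0 PD Pp x; rewrite (tens_sum_pure x).
by apply: (big_ind P) => // p _; apply: Pp.
Qed.

End TensorProduct.

Notation "u \ox v" := (tens_pure u v) (at level 40, left associativity) :
  ring_scope.

Lemma exists_functional (K : fieldType) (V : lmodType K) (v0 : V) :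
  v0 != 0 -> exists2 f : V -> K^o, linear f & f v0 = 1.
Proof.
move=> v0N0.
pose P (D : set V) := [/\ forall a x y, D x -> D y -> D (a *: x + y), D 0
                        & ~ D v0].
have PD0 : P [set 0].
  split=> [a x y -> ->| |/= /eqP]; rewrite /= ?scaler0 ?addr0 //.
  by rewrite (negPf v0N0).
have [F FP Ftot|D [PD Dmax]] := @Zorn_bigcup V (fun D => P D \/ D = set0).
  have [F0|/existsNP[X0 /not_implyP[FX0 X00]]] :=
    pselect (forall X, F X -> X = set0).
    by right; rewrite -subset0 => x [X /F0->].
  left.
  have PX X x : F X -> X x -> P X.
    by move=> /FP[//|->].
  split.
  - move=> a x y [X FX Xx] [Y FY Yy].
    have [XY|YX] := Ftot _ _ FX FY.
      by exists Y => //; have [Yl _ _] := PX _ _ FY Yy; apply: Yl => //; apply: XY.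
    by exists X => //; have [Xl _ _] := PX _ _ FX Xx; apply: Xl => //; apply: YX.
  - have [x X0x] : X0 !=set0 by apply/set0P/eqP.
    by exists X0 => //; have [] := PX _ _ FX0 X0x.
  - by move=> [X FX Xv0]; have [_ _ /(_ Xv0)] := PX _ _ FX Xv0.
have {PD}[Dlin D0 Dv0] : P D.
  case: PD => // D0; case: (Dmax [set 0]); last by left.
  by rewrite D0; split => // /(_ 0); apply.
have DZ a x : D x -> D (a *: x) by move=> Dx; rewrite -[_ *: _]addr0; apply: Dlin.
have ex x : exists c : K, D (x - c *: v0).
  have [Dx|nDx] := pselect (D x); first by exists 0; rewrite scale0r subr0.
  pose D' := [set y | exists c d, D d /\ y = c *: x + d].
  have DD' : D `<=` D' by move=> d Dd; exists 0, d; rewrite scale0r add0r.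
  have D'x : D' x by exists 1, 0; rewrite scale1r addr0.
  have /not_orP[nP _] : ~ (P D' \/ D' = set0).
    by apply: Dmax; split=> // /(_ _ D'x).
  have D'v0 : D' v0.
    apply: contrapT => nD'; apply: nP; split=> //; last exact: DD'.
    move=> a y z [c [d [Dd ->]]] [c' [d' [Dd' ->]]].
    exists (a * c + c'), (a *: d + d'); split; first exact: Dlin.
    by rewrite scalerDr scalerA scalerDl addrACA.
  have [c [d [Dd v0E]]] := D'v0.
  have cN0 : c != 0.
    by apply/eqP => c0; apply: Dv0; rewrite v0E c0 scale0r add0r.
  exists c^-1; rewrite v0E scalerDr scalerA mulVf // scale1r opprD addNKr.
  by rewrite -scaleNr; apply: DZ.
have [f fP] := choice ex.
have uniq x c : D (x - c *: v0) -> f x = c.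
  move=> Dc; apply: contrapT => /eqP fc; apply: Dv0.
  have := Dlin (-1) _ _ Dc (fP x).
  rewrite scaleN1r opprB addrA subrK -scalerBl => /(DZ (c - f x)^-1).
  by rewrite scalerA mulVf ?scale1r // subr_eq0 eq_sym.
exists f; last by apply: uniq; rewrite scale1r subrr.
move=> a x y; apply: uniq.
have := Dlin a _ _ (fP x) (fP y).
by rewrite scalerBr scalerA scalerDl opprD addrACA.
Qed.

Section TensorAlgebra.
Variables (K : fieldType) (A B : comAlgType K).

Definition tens_mul (x y : tens A B) : tens A B :=
  tens_lift (fun a b => tens_lift (fun a' b' => (a * a') \ox (b * b')) y) x.

Let inner_bilinear (a : A) (b : B) :
  bilinear_for *:%R *:%R (fun a' b' => (a * a') \ox (b * b')).
Proof.
split=> [v|u] c x y /=; rewrite mulrDr -scalerAr.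
- exact: (tens_pure_bilinear _ _).1.
- exact: (tens_pure_bilinear _ _).2.
Qed.

Let outer_bilinear (y : tens A B) : bilinear_for *:%R *:%R
  (fun a b => tens_lift (fun a' b' => (a * a') \ox (b * b')) y).
Proof.
split=> [v|u] c x z; rewrite /= /tens_lift scaler_sumr -big_split /=;
    apply: eq_bigr => p _; rewrite mulrDl -scalerAl.
- exact: (tens_pure_bilinear _ _).1.
- exact: (tens_pure_bilinear _ _).2.
Qed.

Lemma tens_mul_pure a b a' b' :
  tens_mul (a \ox b) (a' \ox b') = (a * a') \ox (b * b').
Proof. by rewrite /tens_mul !tens_lift_pure. Qed.

Let tens_mulDl : left_distributive tens_mul +%R.
Proof.
move=> x y z; have := tens_lift_linear (outer_bilinear z) 1 x y.
by rewrite !scale1r.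
Qed.

Let tens_mulZl c x y : tens_mul (c *: x) y = c *: tens_mul x y.
Proof.
have /= := tens_lift_linear (outer_bilinear y) c x 0.
have := tens_lift_linear (outer_bilinear y) (-1) x x.
rewrite !scaleN1r !addNr => ->.
by rewrite !addr0.
Qed.

Let tens_mulC : commutative tens_mul.
Proof.
have Dr x y z : tens_mul x (y + z) = tens_mul x y + tens_mul x z.
  rewrite /tens_mul /(tens_lift _ x) -big_split /=; apply: eq_bigr => p _.
  have := tens_lift_linear (inner_bilinear p.1 p.2) 1 y z.
  by rewrite !scale1r.
have m0 x : tens_mul x 0 = 0.
  by apply: (@addIr _ (tens_mul x 0)); rewrite -Dr !add0r.
have m0' x : tens_mul 0 x = 0 by have := tens_mulZl 0 0 x; rewrite !scale0r.
elim/tens_ind=> [y|x x' IH IH' y|a b]; first by rewrite m0 m0'.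
  by rewrite tens_mulDl Dr IH IH'.
elim/tens_ind=> [|y y' IH IH'|a' b']; first by rewrite m0 m0'.
  by rewrite tens_mulDl Dr IH IH'.
by rewrite !tens_mul_pure mulrC [b * _]mulrC.
Qed.

Let tens_mul0 x : tens_mul 0 x = 0.
Proof. by have := tens_mulZl 0 0 x; rewrite !scale0r. Qed.

Let tens_mulDr x y z : tens_mul x (y + z) = tens_mul x y + tens_mul x z.
Proof. by rewrite tens_mulC tens_mulDl !(tens_mulC x). Qed.

Let tens_mulA : associative tens_mul.
Proof.
elim/tens_ind=> [y z|x x' IH IH' y z|a b]; first by rewrite !tens_mul0.
  by rewrite !tens_mulDl IH IH'.
elim/tens_ind=> [z|y y' IH IH' z|a' b'].
- by rewrite tens_mul0 (tens_mulC _ 0) !tens_mul0.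
- by rewrite tens_mulDl !tens_mulDr tens_mulDl IH IH'.
elim/tens_ind=> [|z z' IH IH'|a'' b''].
- by rewrite !(tens_mulC _ 0) !tens_mul0 (tens_mulC _ 0) tens_mul0.
- by rewrite !tens_mulDr IH IH'.
by rewrite !tens_mul_pure !mulrA.
Qed.

Let tens_mul1 : left_id (1 \ox 1) tens_mul.
Proof.
elim/tens_ind=> [|x y IH IH'|a b]; first by rewrite tens_mulC tens_mul0.
  by rewrite tens_mulDr IH IH'.
by rewrite tens_mul_pure !mul1r.
Qed.

Let tens_oneN0 : 1 \ox 1 != 0 :> tens A B.
Proof.
have [f lf f1] := exists_functional (oner_neq0 A).
have [g lg g1] := exists_functional (oner_neq0 B).
pose h a b : K^o := f a * g b.
have hb : bilinear_for *:%R *:%R h.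
  split=> [v|u] c x y; rewrite /h /=.
  - by rewrite lf mulrDl scalerAl.
  - by rewrite lg mulrDr scalerAr.
apply/eqP => /(congr1 (tens_lift h)); rewrite tens_lift_pure // /h f1 g1 mulr1.
rewrite ev_zero // => /eqP; by rewrite oner_eq0.
Qed.

HB.instance Definition _ := GRing.Zmodule_isComNzRing.Build (tens A B)
  tens_mulA tens_mulC tens_mul1 tens_mulDl tens_oneN0.

Let tens_scalerAl (c : K) (x y : tens A B) : c *: (x * y) = (c *: x) * y.
Proof. by rewrite -[RHS]/(tens_mul _ _) tens_mulZl. Qed.

HB.instance Definition _ :=
  GRing.Lmodule_isLalgebra.Build K (tens A B) tens_scalerAl.
HB.instance Definition _ := GRing.Lalgebra_isComAlgebra.Build K (tens A B).

Lemma tens_pureM (a a' : A) (b b' : B) :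
  (a \ox b) * (a' \ox b') = (a * a') \ox (b * b').
Proof. exact: tens_mul_pure. Qed.

Lemma tens_pure1 : 1 \ox 1 = 1 :> tens A B.
Proof. by []. Qed.

End TensorAlgebra.

Section TensorMaps.
Variable K : fieldType.

Definition tens_map (U U' V V' : lmodType K) (f : U -> U') (g : V -> V') :
    tens U V -> tens U' V' :=
  tens_lift (fun u v => f u \ox g v).

Definition tens_swap (U V : lmodType K) : tens U V -> tens V U :=
  tens_lift (fun u v => v \ox u).

Definition tens_assoc (U V W : lmodType K) :
    tens (tens U V) W -> tens U (tens V W) :=
  tens_lift (fun t w => tens_lift (fun u v => u \ox (v \ox w)) t).

Definition tens_nabla (A : comAlgType K) : tens A A -> A :=
  tens_lift (fun a b => a * b).

Lemma tens_map_bilinear (U U' V V' : lmodType K) (f : U -> U') (g : V -> V') :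
  linear f -> linear g -> bilinear_for *:%R *:%R (fun u v => f u \ox g v).
Proof.
move=> lf lg; split=> [v|u] a x y /=; rewrite ?lf ?lg.
- exact: (tens_pure_bilinear _ _).1.
- exact: (tens_pure_bilinear _ _).2.
Qed.

Lemma tens_map_pure (U U' V V' : lmodType K) (f : U -> U') (g : V -> V') u v :
  linear f -> linear g -> tens_map f g (u \ox v) = f u \ox g v.
Proof. by move=> lf lg; apply: tens_lift_pure; apply: tens_map_bilinear. Qed.

Lemma tens_map_linear (U U' V V' : lmodType K) (f : U -> U') (g : V -> V') :
  linear f -> linear g -> linear (tens_map f g).
Proof. by move=> lf lg; apply: tens_lift_linear; apply: tens_map_bilinear. Qed.

End TensorMaps.

Record bialgebra (K : fieldType) := Bialgebra {
  bialg_alg :> comAlgType K;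
  comul : {lrmorphism bialg_alg -> tens bialg_alg bialg_alg};
  counit : {lrmorphism bialg_alg -> K^o};
  comul_coassoc : forall b,
    tens_assoc (tens_map comul id (comul b)) = tens_map id comul (comul b);
  comul_counitl : forall b, tens_lift (fun x y => counit x *: y) (comul b) = b;
  comul_counitr : forall b, tens_lift (fun x y => counit y *: x) (comul b) = b;
  comul_cocomm : forall b, tens_swap (comul b) = comul b
}.

Definition unit_counit (K : fieldType) (B : bialgebra K) (b : B) : B :=
  (counit B b)%:A.

Definition convolution (K : fieldType) (B : bialgebra K) (f g : B -> B) (b : B) : B :=
  tens_nabla (tens_map f g (comul B b)).

(* scaling is the extended map, with 0^* = unit_counit; a bialgebra
   endomorphism is an algebra morphism compatible with comul and counit. *)
Record scaledBialgebra (K : fieldType) := ScaledBialgebra {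
  scaled_bialg :> bialgebra K;
  scaling : K -> {lrmorphism scaled_bialg -> scaled_bialg};
  scaling_comul : forall a b,
    comul scaled_bialg (scaling a b) =
    tens_map (scaling a) (scaling a) (comul scaled_bialg b);
  scaling_counit : forall a b,
    counit scaled_bialg (scaling a b) = counit scaled_bialg b;
  scaling0 : scaling 0 =1 @unit_counit K scaled_bialg;
  scaling1 : scaling 1 =1 id;
  scalingD : forall a b, scaling (a + b) =1 convolution (scaling a) (scaling b);
  scalingM : forall a b, scaling (a * b) =1 scaling a \o scaling b
}.

Section TensorPower.
Variables (K : fieldType) (B : comAlgType K).

Fixpoint tpow (n : nat) : comAlgType K :=
  if n is m.+1 then tens (tpow m) B else K^o.

Fixpoint tpow_pure (n : nat) : ('I_n -> B) -> tpow n :=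
  match n with
  | 0 => fun _ => 1
  | m.+1 => fun b =>
      tpow_pure (fun i => b (widen_ord (leqnSn m) i)) \ox b ord_max
  end.

(* f_1 (x) ... (x) f_n *)
Fixpoint tpow_map (n : nat) : ('I_n -> B -> B) -> tpow n -> tpow n :=
  match n with
  | 0 => fun _ => id
  | m.+1 => fun f =>
      tens_map (tpow_map (fun i => f (widen_ord (leqnSn m) i))) (f ord_max)
  end.

(* The linear extension of b_1 (x) ... (x) b_n |-> f_1 b_1 * ... * f_n b_n *)
Fixpoint tpow_prod (A : comAlgType K) (n : nat) : ('I_n -> B -> A) -> tpow n -> A :=
  match n with
  | 0 => fun _ (c : K^o) => (c : K)%:A
  | m.+1 => fun f => tens_lift (fun x b =>
      tpow_prod (fun i => f (widen_ord (leqnSn m) i)) x * f ord_max b)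
  end.

Lemma tpow_map_linear n (f : 'I_n -> B -> B) :
  (forall i, linear (f i)) -> linear (tpow_map f).
Proof.
elim: n f => [|n IHn] f lf //=; apply: tens_map_linear; last exact: lf.
by apply: IHn => i; apply: lf.
Qed.

Lemma tpow_map_pure n (f : 'I_n -> B -> B) (b : 'I_n -> B) :
  (forall i, linear (f i)) ->
  tpow_map f (tpow_pure b) = tpow_pure (fun i => f i (b i)).
Proof.
elim: n f b => [|n IHn] f b lf //=.
rewrite tens_map_pure ?IHn //.
by apply: tpow_map_linear.
Qed.

Lemma tpow_prod_bilinear (A : comAlgType K) n (f : tpow n -> A) (g : B -> A) :
  linear f -> linear g -> bilinear_for *:%R *:%R (fun x b => f x * g b).
Proof.
move=> lf lg; split=> [b|x] a y z /=.
- by rewrite lf mulrDl scalerAl.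
- by rewrite lg mulrDr scalerAr.
Qed.

Lemma tpow_prod_linear (A : comAlgType K) n (f : 'I_n -> B -> A) :
  (forall i, linear (f i)) -> linear (tpow_prod f).
Proof.
elim: n f => [|n IHn] f lf /=.
  by move=> a x y; rewrite scalerDl scalerA.
apply: tens_lift_linear; apply: tpow_prod_bilinear => //.
by apply: IHn => i; apply: lf.
Qed.

Lemma tpow_prod_pure (A : comAlgType K) n (f : 'I_n -> B -> A) (b : 'I_n -> B) :
  (forall i, linear (f i)) ->
  tpow_prod f (tpow_pure b) = \prod_(i < n) f i (b i).
Proof.
elim: n f b => [|n IHn] f b lf; first by rewrite big_ord0 /= scale1r.
rewrite big_ord_recr /= tens_lift_pure ?IHn //.
by apply: tpow_prod_bilinear => //; apply: tpow_prod_linear.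
Qed.

Definition tpow_incl (n : nat) (x : tpow n) : tpow n.+1 := x \ox 1.

Let tpow_incl_linear n : linear (@tpow_incl n).
Proof. by move=> a x y; exact: (tens_pure_bilinear _ _).1. Qed.

Let tpow_incl_monoid n : GRing.monoid_morphism (@tpow_incl n).
Proof. by split=> // x y; rewrite /tpow_incl tens_pureM mulr1. Qed.

HB.instance Definition _ n :=
  GRing.isLinear.Build K (tpow n) (tpow n.+1) _ (@tpow_incl n) (@tpow_incl_linear n).
HB.instance Definition _ n :=
  GRing.isMonoidMorphism.Build (tpow n) (tpow n.+1) (@tpow_incl n)
    (@tpow_incl_monoid n).

Lemma tpow_incl_inj n : injective (@tpow_incl n).
Proof.
have [f lf f1] := exists_functional (oner_neq0 B).
pose g (x : tpow n) (b : B) : tpow n := f b *: x.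
have gb : bilinear_for *:%R *:%R g.
  split=> [b|x] a y z; rewrite /g /=.
  - by rewrite scalerDr !scalerA mulrC.
  - by rewrite lf scalerDl scalerA.
by apply: (can_inj (g := tens_lift g)) => x; rewrite tens_lift_pure // /g f1 scale1r.
Qed.

End TensorPower.

Section IteratedCoproduct.
Variables (K : fieldType) (B : bialgebra K).

Fixpoint itcomul (n : nat) : B -> tpow B n :=
  match n with
  | 0 => counit B
  | m.+1 => fun b => tens_map (itcomul m) id (comul B b)
  end.

(* Under the identification of tpow B 1 = tens K B with B, the coproduct
   itcomul 1 is the identity. *)
Lemma itcomul1 (b : B) : itcomul 1 b = (1 : K^o) \ox b.
Proof.
rewrite /= -{2}[b]comul_counitl.
have lc : linear (counit B : B -> K^o) by move=> a x y; rewrite linearP.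
have li : linear (@id B) by [].
have bb : bilinear_for *:%R *:%R (fun x y : B => counit B x *: y).
  split=> [y|x] a u v /=; first by rewrite lc scalerDl scalerA.
  by rewrite scalerDr !scalerA mulrC.
apply: (tens_lift_unique (f := tens_map (counit B : B -> K^o) id)
  (g := fun x => (1 : K^o) \ox tens_lift (fun x y : B => counit B x *: y) x)).
- exact: tens_map_linear.
- by move=> a x y; rewrite tens_lift_linear //; apply: (tens_pure_bilinear _ _).2.
move=> x y; rewrite tens_map_pure // tens_lift_pure // tens_pureZr -tens_pureZl.
by rewrite [_ *: 1]mulr1.
Qed.

End IteratedCoproduct.

Section InducedAction.
Variables (K : fieldType) (B : scaledBialgebra K).

Definition row_star (n : nat) (a : 'rV[K]_n) (b : B) : tpow B n :=
  tpow_map (fun i => scaling B (a 0 i)) (itcomul n b).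

Definition mx_star (n : nat) (M : 'M[K]_n) : tpow B n -> tpow B n :=
  tpow_prod (fun i => row_star (row i M)).

End InducedAction.

(* The inclusions of an ascending algebra are given as injective algebra
   morphisms. *)
Record ascAlg (K : fieldType) := AscAlg {
  asc_alg :> nat -> comAlgType K;
  asc_incl : forall n, {lrmorphism asc_alg n -> asc_alg n.+1};
  asc_incl_inj : forall n, injective (asc_incl n);
  asc_alg0 : bijective (fun c : K => c%:A : asc_alg 0)
}.

Section DirectLimit.
Variables (K : fieldType) (F : ascAlg K).

(* The image of x : F n in F m if n <= m, and 0 if (m < n)%N. *)
Fixpoint asc_to (n : nat) (x : F n) (m : nat) : F m :=
  let below := if m is k.+1 return F m then asc_incl F k (asc_to x k) else 0 in
  if eq_comparable n m is left e then ecast k (F k) e x else below.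

Lemma asc_to_id n (x : F n) : asc_to x n = x.
Proof.
have H : forall (e : n = n), ecast k (F k) e x = x.
  by move=> e; rewrite eq_axiomK.
by case: n x H => [|n] x H /=; [case: (eq_comparable 0%N 0%N) | case: (eq_comparable n.+1 n.+1)].
Qed.

Lemma asc_toS n (x : F n) m : (n <= m)%N -> asc_to x m.+1 = asc_incl F m (asc_to x m).
Proof.
move=> nm /=; case: (eq_comparable n m.+1) => // e.
by exfalso; move: nm; rewrite e ltnn.
Qed.

Lemma asc_to_gt n (x : F n) m : (m < n)%N -> asc_to x m = 0.
Proof.
elim: m => [|m IHm] /= mn.
  by case: (eq_comparable n 0%N) => // e; exfalso; move: mn; rewrite e.
case: (eq_comparable n m.+1) => [e|_]; first by exfalso; move: mn; rewrite e ltnn.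
by rewrite IHm ?raddf0 // ltnW.
Qed.

Lemma asc_to_trans n (x : F n) m k :
  (n <= m)%N -> (m <= k)%N -> asc_to (asc_to x m) k = asc_to x k.
Proof.
move=> nm /subnK <-; elim: (k - m)%N => [|d IHd]; first exact: asc_to_id.
rewrite addSn !asc_toS ?IHd ?leq_addl //.
by apply: leq_trans nm _; apply: leq_addl.
Qed.

Lemma asc_toD n (x y : F n) m : asc_to (x + y) m = asc_to x m + asc_to y m.
Proof.
have [mn|nm] := ltnP m n; first by rewrite !asc_to_gt ?addr0.
rewrite -(subnK nm); elim: (m - n)%N => [|d IHd]; first by rewrite !asc_to_id.
by rewrite addSn !asc_toS ?IHd ?rmorphD ?leq_addl.
Qed.

Lemma asc_toZ n (a : K) (x : F n) m : asc_to (a *: x) m = a *: asc_to x m.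
Proof.
have [mn|nm] := ltnP m n; first by rewrite !asc_to_gt ?scaler0.
rewrite -(subnK nm); elim: (m - n)%N => [|d IHd]; first by rewrite !asc_to_id.
by rewrite addSn !asc_toS ?IHd ?linearZ ?leq_addl.
Qed.

Lemma asc_toM n (x y : F n) m : asc_to (x * y) m = asc_to x m * asc_to y m.
Proof.
have [mn|nm] := ltnP m n; first by rewrite !asc_to_gt ?mulr0.
rewrite -(subnK nm); elim: (m - n)%N => [|d IHd]; first by rewrite !asc_to_id.
by rewrite addSn !asc_toS ?IHd ?rmorphM ?leq_addl.
Qed.

Lemma asc_to1 n m : (n <= m)%N -> asc_to (1 : F n) m = 1.
Proof.
move=> /subnK <-; elim: (m - n)%N => [|d IHd]; first by rewrite asc_to_id.
by rewrite addSn !asc_toS ?IHd ?rmorph1 ?leq_addl.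
Qed.

Lemma asc_to_inj n m : (n <= m)%N -> injective (fun x : F n => asc_to x m).
Proof.
move=> /subnK <-; elim: (m - n)%N => [|d IHd] x y; first by rewrite !asc_to_id.
by rewrite addSn !asc_toS ?leq_addl // => /asc_incl_inj/IHd.
Qed.

Definition dirlim_eq : rel {n : nat & F n} := fun s t =>
  asc_to (tagged s) (maxn (tag s) (tag t)) ==
  asc_to (tagged t) (maxn (tag s) (tag t)).

Lemma dirlim_eqP s t k : (tag s <= k)%N -> (tag t <= k)%N ->
  reflect (asc_to (tagged s) k = asc_to (tagged t) k) (dirlim_eq s t).
Proof.
move=> sk tk; have mk : (maxn (tag s) (tag t) <= k)%N by rewrite geq_max sk.
rewrite /dirlim_eq -(inj_eq (asc_to_inj mk)) !asc_to_trans ?leq_maxl ?leq_maxr //.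
exact: eqP.
Qed.

Lemma dirlim_eq_refl : reflexive dirlim_eq.
Proof. by move=> s; apply/(dirlim_eqP (leqnn _) (leqnn _)). Qed.

Lemma dirlim_eq_sym : symmetric dirlim_eq.
Proof. by move=> s t; rewrite /dirlim_eq maxnC eq_sym. Qed.

Lemma dirlim_eq_trans : transitive dirlim_eq.
Proof.
move=> t s r; pose k := maxn (tag s) (maxn (tag t) (tag r)).
have sk : (tag s <= k)%N by rewrite leq_maxl.
have tk : (tag t <= k)%N by rewrite /k maxnCA leq_maxl.
have rk : (tag r <= k)%N by rewrite /k maxnA leq_maxr.
move=> /(dirlim_eqP sk tk) st /(dirlim_eqP tk rk) tr.
by apply/(dirlim_eqP sk rk); rewrite st.
Qed.

Canonical dirlim_equiv :=
  EquivRel dirlim_eq dirlim_eq_refl dirlim_eq_sym dirlim_eq_trans.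

Definition dirlim := {eq_quot dirlim_eq}.
HB.instance Definition _ := Choice.on dirlim.
HB.instance Definition _ := EqQuotient.on dirlim.

Definition dirlim_in (n : nat) (x : F n) : dirlim :=
  \pi_dirlim (Tagged (fun k => F k : Type) x).

Lemma dirlim_in_eq n (x : F n) m (y : F m) k : (n <= k)%N -> (m <= k)%N ->
  dirlim_in x = dirlim_in y <-> asc_to x k = asc_to y k.
Proof.
move=> nk mk; split.
  by move=> /eqmodP/(@dirlim_eqP (existT _ n x) (existT _ m y) k nk mk).
by move=> xy; apply/eqmodP/(@dirlim_eqP (existT _ n x) (existT _ m y) k nk mk).
Qed.

Lemma dirlim_in_inj n : injective (@dirlim_in n).
Proof. by move=> x y /(dirlim_in_eq _ _ (leqnn n) (leqnn n)); rewrite !asc_to_id. Qed.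

Lemma dirlim_in_to n (x : F n) m : (n <= m)%N -> dirlim_in (asc_to x m) = dirlim_in x.
Proof.
by move=> nm; apply/(dirlim_in_eq _ _ (leqnn m) nm); rewrite asc_to_id.
Qed.

Lemma dirlim_in_surj (x : dirlim) : exists n (a : F n), x = dirlim_in a.
Proof.
by exists (tag (repr x)), (tagged (repr x)); rewrite -[LHS]reprK; case: (repr x).
Qed.

Lemma dirlim_in_surj2 (x y : dirlim) :
  exists n (a b : F n), x = dirlim_in a /\ y = dirlim_in b.
Proof.
have [n [a ->]] := dirlim_in_surj x; have [m [b ->]] := dirlim_in_surj y.
exists (maxn n m), (asc_to a (maxn n m)), (asc_to b (maxn n m)).
by rewrite !dirlim_in_to ?leq_maxl ?leq_maxr.
Qed.

Lemma dirlim_in_surj3 (x y z : dirlim) :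
  exists n (a b c : F n), [/\ x = dirlim_in a, y = dirlim_in b & z = dirlim_in c].
Proof.
have [n [a [b [-> ->]]]] := dirlim_in_surj2 x y.
have [m [c ->]] := dirlim_in_surj z.
exists (maxn n m), (asc_to a (maxn n m)), (asc_to b (maxn n m)),
  (asc_to c (maxn n m)).
by rewrite !dirlim_in_to ?leq_maxl ?leq_maxr.
Qed.

Definition dirlim_op (op : forall n, F n -> F n -> F n) (x y : dirlim) : dirlim :=
  let m := maxn (tag (repr x)) (tag (repr y)) in
  dirlim_in (op m (asc_to (tagged (repr x)) m) (asc_to (tagged (repr y)) m)).

Lemma dirlim_repr n (a : F n) m : (n <= m)%N -> (tag (repr (dirlim_in a)) <= m)%N ->
  asc_to (tagged (repr (dirlim_in a))) m = asc_to a m.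
Proof.
move=> nm rm; apply/(dirlim_in_eq _ _ rm nm).
by rewrite -[RHS]reprK; case: (repr _).
Qed.

Lemma dirlim_opE (op : forall n, F n -> F n -> F n) :
  (forall n m (x y : F n), (n <= m)%N -> asc_to (op n x y) m = op m (asc_to x m) (asc_to y m)) ->
  forall n (a b : F n), dirlim_op op (dirlim_in a) (dirlim_in b) = dirlim_in (op n a b).
Proof.
move=> opH n a b; rewrite /dirlim_op; set m := maxn _ _.
have am : (tag (repr (dirlim_in a)) <= m)%N by apply: leq_maxl.
have bm : (tag (repr (dirlim_in b)) <= m)%N by apply: leq_maxr.
have mk := leq_maxl m n; have nk := leq_maxr m n.
apply/(dirlim_in_eq _ _ mk nk).
by rewrite !opH // !asc_to_trans // !dirlim_repr // (leq_trans _ mk).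
Qed.

Definition dirlim_add := dirlim_op (fun n => +%R).
Definition dirlim_mul := dirlim_op (fun n => *%R).
Definition dirlim_scale (a : K) (x : dirlim) : dirlim :=
  dirlim_in (a *: tagged (repr x)).
Definition dirlim_opp (x : dirlim) : dirlim := dirlim_scale (-1) x.

Let inD n (a b : F n) : dirlim_add (dirlim_in a) (dirlim_in b) = dirlim_in (a + b).
Proof. by apply: (dirlim_opE (op := fun n => +%R)) => *; apply: asc_toD. Qed.

Let inM n (a b : F n) : dirlim_mul (dirlim_in a) (dirlim_in b) = dirlim_in (a * b).
Proof. by apply: (dirlim_opE (op := fun n => *%R)) => *; apply: asc_toM. Qed.

Let inZ n c (a : F n) : dirlim_scale c (dirlim_in a) = dirlim_in (c *: a).
Proof.
rewrite /dirlim_scale; set m := tag _; have mk := leq_maxl m n.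
have nk := leq_maxr m n; apply/(dirlim_in_eq _ _ mk nk).
by rewrite !asc_toZ dirlim_repr.
Qed.

Let in0 n : dirlim_in (0 : F 0) = dirlim_in (0 : F n).
Proof.
apply/(dirlim_in_eq _ _ (leq0n n) (leqnn n)).
have to0 m k : asc_to (0 : F m) k = 0.
  by have := asc_toZ 0 (0 : F m) k; rewrite !scale0r.
by rewrite !to0.
Qed.

Let in1 n : dirlim_in (1 : F 0) = dirlim_in (1 : F n).
Proof.
by apply/(dirlim_in_eq _ _ (leq0n n) (leqnn n)); rewrite !asc_to1.
Qed.

Let addA : associative dirlim_add.
Proof.
move=> x y z; have [n [a [b [c [-> -> ->]]]]] := dirlim_in_surj3 x y z.
by rewrite !inD addrA.
Qed.

Let addC : commutative dirlim_add.
Proof.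
move=> x y; have [n [a [b [-> ->]]]] := dirlim_in_surj2 x y.
by rewrite !inD addrC.
Qed.

Let add0 : left_id (dirlim_in (0 : F 0)) dirlim_add.
Proof.
by move=> x; have [n [a ->]] := dirlim_in_surj x; rewrite (in0 n) inD add0r.
Qed.

Let addN : left_inverse (dirlim_in (0 : F 0)) dirlim_opp dirlim_add.
Proof.
move=> x; have [n [a ->]] := dirlim_in_surj x.
by rewrite /dirlim_opp inZ inD scaleN1r addNr (in0 n).
Qed.

HB.instance Definition _ := GRing.isZmodule.Build dirlim addA addC add0 addN.

Let scaleA a b x : dirlim_scale a (dirlim_scale b x) = dirlim_scale (a * b) x.
Proof.
by have [n [c ->]] := dirlim_in_surj x; rewrite !inZ scalerA.
Qed.

Let scale1 : left_id 1 dirlim_scale.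
Proof. by move=> x; have [n [c ->]] := dirlim_in_surj x; rewrite inZ scale1r. Qed.

Let scaleDr : right_distributive dirlim_scale +%R.
Proof.
move=> c x y; have [n [a [b [-> ->]]]] := dirlim_in_surj2 x y.
rewrite -[LHS]/(dirlim_scale c (dirlim_add _ _)).
by rewrite -[RHS]/(dirlim_add _ _) inD !inZ inD scalerDr.
Qed.

Let scaleDl x : {morph dirlim_scale^~ x : a b / a + b}.
Proof.
move=> a b; have [n [c ->]] := dirlim_in_surj x.
by rewrite -[RHS]/(dirlim_add _ _) !inZ inD scalerDl.
Qed.

HB.instance Definition _ := GRing.Zmodule_isLmodule.Build K dirlim
  scaleA scale1 scaleDr scaleDl.

Let mulA : associative dirlim_mul.
Proof.
move=> x y z; have [n [a [b [c [-> -> ->]]]]] := dirlim_in_surj3 x y z.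
by rewrite !inM mulrA.
Qed.

Let mulC : commutative dirlim_mul.
Proof.
move=> x y; have [n [a [b [-> ->]]]] := dirlim_in_surj2 x y.
by rewrite !inM mulrC.
Qed.

Let mul1 : left_id (dirlim_in (1 : F 0)) dirlim_mul.
Proof.
by move=> x; have [n [a ->]] := dirlim_in_surj x; rewrite (in1 n) inM mul1r.
Qed.

Let mulDl : left_distributive dirlim_mul +%R.
Proof.
move=> x y z; have [n [a [b [c [-> -> ->]]]]] := dirlim_in_surj3 x y z.
rewrite -[LHS]/(dirlim_mul (dirlim_add _ _) _).
by rewrite -[RHS]/(dirlim_add _ _) inD !inM inD mulrDl.
Qed.

Let oneN0 : dirlim_in (1 : F 0) != 0.
Proof. by apply/eqP => /dirlim_in_inj/eqP; rewrite oner_eq0. Qed.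

HB.instance Definition _ :=
  GRing.Zmodule_isComNzRing.Build dirlim mulA mulC mul1 mulDl oneN0.

Let scalerAl (c : K) (x y : dirlim) : c *: (x * y) = (c *: x) * y.
Proof.
have [n [a [b [-> ->]]]] := dirlim_in_surj2 x y.
by rewrite -[LHS]/(dirlim_scale _ (dirlim_mul _ _))
  -[RHS]/(dirlim_mul (dirlim_scale _ _) _) inZ !inM inZ scalerAl.
Qed.

HB.instance Definition _ := GRing.Lmodule_isLalgebra.Build K dirlim scalerAl.
HB.instance Definition _ := GRing.Lalgebra_isComAlgebra.Build K dirlim.

Let dirlim_in_linear n : linear (@dirlim_in n).
Proof.
move=> c a b; rewrite -[RHS]/(dirlim_add (dirlim_scale _ _) _).
by rewrite inZ inD.
Qed.

Let dirlim_in_monoid n : GRing.monoid_morphism (@dirlim_in n).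
Proof. by split=> [|a b]; [rewrite -in1 | rewrite -inM]. Qed.

HB.instance Definition _ n :=
  GRing.isLinear.Build K (F n) dirlim _ (@dirlim_in n) (@dirlim_in_linear n).
HB.instance Definition _ n :=
  GRing.isMonoidMorphism.Build (F n) dirlim (@dirlim_in n) (@dirlim_in_monoid n).

Lemma dirlim_in_incl n (x : F n) : dirlim_in (asc_incl F n x) = dirlim_in x.
Proof. by rewrite -(dirlim_in_to x (leqnSn n)) asc_toS // asc_to_id. Qed.

(* F_n, as a subset of the union of the F_n. *)
Definition stage (n : nat) : set dirlim := range (@dirlim_in n).

End DirectLimit.

Arguments dirlim_in {K} F {n} x.
Arguments stage {K} F n.

Section TensorTower.
Variables (K : fieldType) (B : comAlgType K).

Let tpow0_bijective : bijective (fun c : K => c%:A : tpow B 0).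
Proof. by exists id => c; apply: mulr1. Qed.

Definition tpow_ascAlg : ascAlg K := {|
  asc_alg := tpow B;
  asc_incl := fun n => (@tpow_incl K B n : {lrmorphism tpow B n -> tpow B n.+1});
  asc_incl_inj := @tpow_incl_inj K B;
  asc_alg0 := tpow0_bijective
|}.

End TensorTower.

Section InfiniteMatrices.
Variable K : fieldType.

(* Rows and columns are indexed from 0. *)
Definition almost_id (M : nat -> nat -> K) : Prop :=
  finite_set [set i | exists j, M i j - (i == j)%:R != 0] /\
  finite_set [set j | exists i, M i j - (i == j)%:R != 0].

Record imx := Imx { imx_fun :> nat -> nat -> K; imx_almost_id : almost_id imx_fun }.

Lemma almost_idP (M : nat -> nat -> K) :
  almost_id M <->
  exists n, forall i j, ~~ ((i < n) && (j < n))%N -> M i j = (i == j)%:R.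
Proof.
have sub (A : set nat) : finite_set A <-> exists n, A `<=` `I_n.
  split=> [|[n An]]; last exact: sub_finite_set (finite_II n).
  move=> /finite_seqP[s ->]; exists (\max_(i <- s) i).+1 => i /= si.
  by rewrite ltnS; apply: (@leq_bigmax_seq _ s xpredT id).
split=> [[/sub[n nP] /sub[m mP]]|[n nP]].
  exists (maxn n m) => i j; rewrite negb_and => /orP[] ij; apply/eqP;
    rewrite -subr_eq0; apply: contraNT ij => ij.
  - by apply: leq_trans (leq_maxl _ _); apply: (nP i); exists j.
  - by apply: leq_trans (leq_maxr _ _); apply: (mP j); exists i.
split; apply/sub; exists n => i [j ij] /=; apply: contraNT ij => ij;
  by rewrite nP ?subrr // negb_and ij ?orbT.
Qed.

Lemma imxP (M N : imx) : (forall i j, M i j = N i j) -> M = N.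
Proof.
case: M N => [M MP] [N NP] /= MN.
have MNE : M = N by apply/funext => i; apply/funext => j.
by case: _ / MNE in NP *; rewrite (Prop_irrelevance MP NP).
Qed.

Lemma fsum_eq1l (F : nat -> K) i : \sum_(k \in [set: nat]) (i == k)%:R * F k = F i.
Proof.
rewrite -(fsbig_widen [set i]) ?fsbig_set1 ?eqxx ?mul1r //.
by move=> k [_ /= /eqP]; rewrite eq_sym => /negPf ->; rewrite mul0r.
Qed.

Lemma fsum_eq1r (F : nat -> K) j : \sum_(k \in [set: nat]) F k * (k == j)%:R = F j.
Proof.
rewrite -[RHS](fsum_eq1l F); apply: eq_fsbigr => k _.
by rewrite mulrC eq_sym.
Qed.

Let imx_one_subproof : almost_id (fun i j => (i == j)%:R).
Proof. by apply/almost_idP; exists 0%N. Qed.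

Definition imx_one : imx := Imx imx_one_subproof.

Let imx_mul_subproof (M N : imx) :
  almost_id (fun i j => \sum_(k \in [set: nat]) M i k * N k j).
Proof.
have /almost_idP[n nP] := imx_almost_id M.
have /almost_idP[m mP] := imx_almost_id N.
apply/almost_idP; exists (maxn n m) => i j.
rewrite negb_and -!leqNgt !geq_max => /orP[/andP[ni mi]|/andP[nj mj]].
- rewrite -(mP i j) -?[RHS](fsum_eq1l (N^~ j)); last by rewrite ltnNge mi.
  by apply: eq_fsbigr => k _; rewrite nP // ltnNge ni.
- rewrite -(nP i j) -?[RHS](fsum_eq1r (M i)); last by rewrite [(j < n)%N]ltnNge nj andbF.
  by apply: eq_fsbigr => k _; rewrite mP // [(j < m)%N]ltnNge mj andbF.
Qed.

Definition imx_mul (M N : imx) : imx := Imx (imx_mul_subproof M N).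

(* diag(M, I) *)
Let imx_of_mx_subproof (n : nat) (M : 'M[K]_n) : almost_id (fun i j =>
  match insub i, insub j with
  | Some i', Some j' => M i' j'
  | _, _ => (i == j)%:R
  end).
Proof.
apply/almost_idP; exists n => i j ij.
case: insubP => // i' i'n _; case: insubP => // j' j'n _.
by move: ij; rewrite i'n j'n.
Qed.

Definition imx_of_mx (n : nat) (M : 'M[K]_n) : imx := Imx (imx_of_mx_subproof M).

(* With rows counted from 0, this is the matrix E_(n+1) of the 1-based
   convention: the identity with the entry (n, n) replaced by 0. *)
Let imx_E_subproof (n : nat) :
  almost_id (fun i j => (i == j)%:R - ((i == n) && (j == n))%:R).
Proof.
apply/almost_idP; exists n.+1 => i j ij; rewrite [X in _ - X]mulrb ifF ?subr0 //.
by apply: contraNF ij => /andP[/eqP-> /eqP->]; rewrite ltnSn.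
Qed.

Definition imx_E (n : nat) : imx := Imx (imx_E_subproof n).

Let imx_cut_subproof (n : nat) (M : imx) :
  almost_id (fun i j => if (i < n)%N then M i j else (i == j)%:R).
Proof.
have /almost_idP[m mP] := imx_almost_id M.
by apply/almost_idP; exists m => i j ij; rewrite mP // if_same.
Qed.

Definition imx_cut (n : nat) (M : imx) : imx := Imx (imx_cut_subproof n M).

End InfiniteMatrices.

Record K_hierarchy (K : fieldType) (F : ascAlg K)
    (act : imx K -> dirlim F -> dirlim F) : Prop := {
  hierarchy_linear : forall M, linear (act M);
  hierarchy_monoid_morphism : forall M, GRing.monoid_morphism (act M);
  hierarchy_one : forall f, act (imx_one K) f = f;
  hierarchy_mul : forall M N f, act (imx_mul M N) f = act N (act M f);
  hierarchy_straight : forall n M f, stage F n f -> act M f = act (imx_cut n M) f;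
  hierarchy_stage : forall n (M : 'M[K]_n) f,
    stage F n f -> stage F n (act (imx_of_mx M) f);
  hierarchy_E : forall n f, stage F n.+1 f -> stage F n (act (imx_E K n) f)
}.

Definition is_induced_action (K : fieldType) (B : scaledBialgebra K)
    (act : imx K -> dirlim (tpow_ascAlg B) -> dirlim (tpow_ascAlg B)) : Prop :=
  forall n (M : 'M[K]_n) (f : tpow B n),
    act (imx_of_mx M) (dirlim_in (tpow_ascAlg B) f) =
    dirlim_in (tpow_ascAlg B) (mx_star M f).

(* Main.v *)
From HB Require Import structures.
Require Import Defs.
From mathcomp Require Import all_boot all_order all_algebra.
From mathcomp Require Import boolp classical_sets cardinality fsbigop.

Set Implicit Arguments.
Unset Strict Implicit.
Unset Printing Implicit Defensive.

Import GRing.Theory.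

Local Open Scope ring_scope.

(** Let B be a scaled bialgebra and A an algebra. The algebra maps B -> A, the
    A-valued points of B, form a K-vector space: the sum is convolution, the
    zero is the counit followed by the unit of A, and a scalar acts by
    precomposition with the scaling. The bialgebra axioms are the axioms of a
    commutative monoid, the semiring law of the scaling gives the remaining
    axioms, and opposites come for free as multiples by -1.

    The algebra B_n = B^(x)n represents n-tuples of points: an algebra map
    B_n -> A is determined by, and can be freely prescribed by, the n points it
    induces on the tensor factors ([tpow_prod]). Passing to the limit H of the
    B_n, algebra maps H -> A are sequences of points of B ([dirlim_lift]), and
    the identity of H corresponds to the sequence xi_0, xi_1, ... of
    insertions of B into the successive tensor factors ([generic]).

    In these terms the induced action is substitution of linear combinations:
    a row a acts on B as the point sum_j a_j xi_j ([dirlim_in_row_star]), so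
    that M^* is the algebra endomorphism of H which sends each xi_i to
    sum_j M_ij xi_j ([matrix_action_induced]). This formula makes sense for
    all of M(K) at once, which gives existence of the action; uniqueness holds
    because every matrix and every element of H live at a common finite level.
    The axioms of a hierarchy become linear algebra in the vector space of
    points: contravariant functoriality is the formula for the entries of a
    matrix product, because postcomposition with an algebra map is linear on
    points; straightness holds because an element of B_n involves
    xi_0, ..., xi_(n-1) only; and E_(n+1) replaces xi_n by the zero point,
    which takes its values in K. *)

(** * Algebra maps out of a tensor product *)

Section Copairing.
Variable K : fieldType.

(** A lifted map is a sum over a representative, so that maps out of a tensor
    product can be compared summand by summand. *)
Lemma tens_lift_comp (U V W W' : lmodType K) (g : W -> W') (b : U -> V -> W) t :
  linear g -> g (tens_lift b t) = tens_lift (fun u v => g (b u v)) t.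
Proof.
move=> lg; pose mg := GRing.isLinear.Build _ _ _ _ g lg.
by pose g' : {linear W -> W'} := HB.pack g mg; apply: (linear_sum g').
Qed.

Lemma eq_tens_lift (U V W : lmodType K) (b c : U -> V -> W) t :
  b =2 c -> tens_lift b t = tens_lift c t.
Proof. by move=> bc; apply: eq_bigr => p _. Qed.

Lemma tens_map_comp (U U' U'' V V' V'' : lmodType K) (f : U' -> U'') (g : V' -> V'')
    (h : U -> U') (k : V -> V') t :
  linear f -> linear g ->
  tens_map f g (tens_map h k t) = tens_map (f \o h) (g \o k) t.
Proof.
move=> lf lg; rewrite [X in tens_map f g X]/tens_map tens_lift_comp.
  by apply: eq_tens_lift => u v; rewrite tens_map_pure.
exact: tens_map_linear.
Qed.

Definition copair (U V : lmodType K) (A : comAlgType K) (f : U -> A) (g : V -> A) :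
  tens U V -> A := tens_lift (fun u v => f u * g v).

Section CopairLinear.
Variables (U V : lmodType K) (A : comAlgType K) (f : U -> A) (g : V -> A).
Hypotheses (lf : linear f) (lg : linear g).

Lemma copair_bilinear : bilinear_for *:%R *:%R (fun u v => f u * g v).
Proof.
split=> [v|u] a x y /=; first by rewrite lf mulrDl scalerAl.
by rewrite lg mulrDr scalerAr.
Qed.

Lemma copair_linear : linear (copair f g).
Proof. exact: tens_lift_linear copair_bilinear. Qed.

Lemma copair_pure u v : copair f g (u \ox v) = f u * g v.
Proof. exact: tens_lift_pure copair_bilinear. Qed.

Lemma copair_map (U' V' : lmodType K) (h : U' -> U) (k : V' -> V) t :
  copair f g (tens_map h k t) = copair (f \o h) (g \o k) t.
Proof.
rewrite /tens_map tens_lift_comp; last exact: copair_linear.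
by apply: eq_tens_lift => u v; rewrite copair_pure.
Qed.

Lemma copair_comp (A' : comAlgType K) (h : {lrmorphism A -> A'}) t :
  h (copair f g t) = copair (h \o f) (h \o g) t.
Proof.
rewrite /copair (tens_lift_comp (g := h)); last exact: linearP.
by apply: eq_tens_lift => u v; rewrite rmorphM.
Qed.

End CopairLinear.

Lemma copair_swap (U V : lmodType K) (A : comAlgType K) (f : U -> A) (g : V -> A) t :
  linear f -> linear g -> copair g f (tens_swap t) = copair f g t.
Proof.
move=> lf lg; rewrite /tens_swap tens_lift_comp; last exact: copair_linear.
by apply: eq_tens_lift => u v; rewrite copair_pure // mulrC.
Qed.

(** Coassociativity of a coproduct turns into associativity of convolution
    through this identity. *)
Lemma copair_assoc (U V W : lmodType K) (A : comAlgType K)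
    (f : U -> A) (g : V -> A) (h : W -> A) t :
  linear f -> linear g -> linear h ->
  copair f (copair g h) (tens_assoc t) = copair (copair f g) h t.
Proof.
move=> lf lg lh; have lgh := copair_linear lg lh.
have lfgh := copair_linear lf lgh.
rewrite /tens_assoc tens_lift_comp //; apply: eq_tens_lift => s w.
rewrite tens_lift_comp // -[RHS]/((fun a => a * h w) (tens_lift _ s)).
rewrite tens_lift_comp; last by move=> a x y; rewrite mulrDl scalerAl.
by apply: eq_tens_lift => u v; rewrite !copair_pure // mulrA.
Qed.

Lemma copair_monoid_morphism (U V A : comAlgType K) (f : U -> A) (g : V -> A) :
  linear f -> linear g -> GRing.monoid_morphism f -> GRing.monoid_morphism g ->
  GRing.monoid_morphism (copair f g).
Proof.
move=> lf lg [f1 fM] [g1 gM]; have lc := copair_linear lf lg.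
split; first by rewrite -tens_pure1 copair_pure // f1 g1 mulr1.
have cD x y : copair f g (x + y) = copair f g x + copair f g y.
  by have := lc 1 x y; rewrite !scale1r.
have c0 : copair f g 0 = 0 by apply: (addIr (copair f g 0)); rewrite -cD !add0r.
elim/tens_ind=> [y|x x' IH IH' y|u v]; first by rewrite mul0r c0 mul0r.
  by rewrite mulrDl !cD IH IH' mulrDl.
elim/tens_ind=> [|y y' IH IH'|u' v']; first by rewrite mulr0 c0 mulr0.
  by rewrite mulrDr !cD IH IH' mulrDr.
by rewrite tens_pureM !copair_pure // fM gM mulrACA.
Qed.

End Copairing.

(** * The vector space of points of a scaled bialgebra *)

Section Points.
Variables (K : fieldType) (B : scaledBialgebra K) (A : comAlgType K).

(** A record of its own, rather than the type of algebra morphisms, so that the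
    vector space structure below can be attached to it. *)
Record algpoint := AlgPoint {
  point_fun :> B -> A;
  point_linear : linear point_fun;
  point_monoid_morphism : GRing.monoid_morphism point_fun
}.

HB.instance Definition _ := gen_eqMixin algpoint.
HB.instance Definition _ := gen_choiceMixin algpoint.

HB.instance Definition _ (p : algpoint) :=
  GRing.isLinear.Build K B A _ (point_fun p) (point_linear p).
HB.instance Definition _ (p : algpoint) :=
  GRing.isMonoidMorphism.Build B A (point_fun p) (point_monoid_morphism p).

Lemma pointP (p q : algpoint) : p =1 q -> p = q.
Proof.
case: p q => [p lp mp] [q lq mq] /= /funext pq; case: _ / pq in lq mq *.
by rewrite (Prop_irrelevance lp lq) (Prop_irrelevance mp mq).
Qed.

Definition point_of (f : {lrmorphism B -> A}) : algpoint :=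
  AlgPoint (fun a => linearP f a) (conj (rmorph1 f) (rmorphM f)).

(* The sum of two points is their convolution; it is again multiplicative
   because A is commutative and the coproduct is an algebra map. *)
Let point_add_linear (p q : algpoint) : linear (copair p q \o comul B).
Proof.
by move=> a x y /=; rewrite linearP copair_linear //; apply: point_linear.
Qed.

Let point_add_monoid_morphism (p q : algpoint) :
  GRing.monoid_morphism (copair p q \o comul B).
Proof.
have [|||| c1 cM] := @copair_monoid_morphism K B B A p q; try by case: p q => ? ? ? [].
by split=> [|x y] /=; rewrite (rmorph1, rmorphM) (c1, cM).
Qed.

Definition point_add (p q : algpoint) : algpoint :=
  AlgPoint (point_add_linear p q) (point_add_monoid_morphism p q).

Let point_zero_linear : linear (fun b => (counit B b : K)%:A : A).
Proof. by move=> a x y; rewrite linearP scalerDl scalerA. Qed.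

Let point_zero_monoid_morphism :
  GRing.monoid_morphism (fun b => (counit B b : K)%:A : A).
Proof.
split=> [|x y]; first by rewrite rmorph1 scale1r.
by rewrite rmorphM -scalerAl mul1r scalerA.
Qed.

Definition point_zero : algpoint := AlgPoint point_zero_linear point_zero_monoid_morphism.

Definition point_scale (a : K) (p : algpoint) : algpoint := point_of (p \o scaling B a).

Definition point_opp (p : algpoint) : algpoint := point_scale (-1) p.

Let plin := point_linear.

Let addA : associative point_add.
Proof.
move=> p q r; apply: pointP => b /=.
have -> : copair p (copair q r \o comul B) (comul B b) =
          copair p (copair q r) (tens_map id (comul B) (comul B b)).
  by rewrite copair_map //; apply: copair_linear.
rewrite -comul_coassoc copair_assoc // copair_map //.
exact: copair_linear.
Qed.

Let addC : commutative point_add.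
Proof. by move=> p q; apply: pointP => b /=; rewrite -copair_swap // comul_cocomm. Qed.

Let add0 : left_id point_zero point_add.
Proof.
move=> p; apply: pointP => b /=; rewrite -[in RHS](comul_counitl b).
rewrite (tens_lift_comp (g := p)) //; apply: eq_tens_lift => x y.
by rewrite linearZ /= -scalerAl mul1r.
Qed.

(* This is the identity of the scaling which relates addition in K to
   convolution, pushed forward along p. *)
Let scaleDl p : {morph point_scale^~ p : a b / a + b >-> point_add a b}.
Proof.
move=> a b; apply: pointP => x /=.
rewrite scalingD /convolution -[tens_nabla _]/(copair id id _).
rewrite copair_map // copair_comp //=; exact: linearP.
Qed.

Let scale0 p : point_scale 0 p = point_zero.
Proof.
by apply: pointP => b /=; rewrite scaling0 /unit_counit linearZ rmorph1.
Qed.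

Let scale1 : left_id 1 point_scale.
Proof. by move=> p; apply: pointP => b /=; rewrite scaling1. Qed.

(* p + (-1) p = (1 + (-1)) p = 0 p, and 0 acts on B as the counit. *)
Let addN : left_inverse point_zero point_opp point_add.
Proof.
by move=> p; rewrite -{2}[p]scale1 /point_opp -scaleDl addNr scale0.
Qed.

HB.instance Definition _ := GRing.isZmodule.Build algpoint addA addC add0 addN.

Let scaleA a b p : point_scale a (point_scale b p) = point_scale (a * b) p.
Proof. by apply: pointP => x /=; rewrite mulrC scalingM. Qed.

(* Scalars distribute over convolution because the scaling maps commute with
   the coproduct. *)
Let scaleDr : right_distributive point_scale +%R.
Proof.
move=> a p q; apply: pointP => b /=.
by rewrite scaling_comul copair_map //; apply: plin.
Qed.

HB.instance Definition _ :=
  GRing.Zmodule_isLmodule.Build K algpoint scaleA scale1 scaleDr scaleDl.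

Lemma point_addE (p q : algpoint) b : (p + q) b = copair p q (comul B b).
Proof. by []. Qed.

Lemma point_zeroE b : (0 : algpoint) b = (counit B b : K)%:A.
Proof. by []. Qed.

End Points.

Section PointComposition.
Variables (K : fieldType) (B : scaledBialgebra K) (A A' : comAlgType K).
Variable g : {lrmorphism A -> A'}.

Definition point_comp (p : algpoint B A) : algpoint B A' := point_of (g \o p).

(* Postcomposition does not interfere with the vector space structure, which
   comes from operations on the source B. *)
Let point_comp_linear : linear point_comp.
Proof.
move=> a p q; apply: pointP => b /=.
by rewrite -[LHS]/(g (copair _ _ _)) copair_comp.
Qed.

HB.instance Definition _ := GRing.isLinear.Build K (algpoint B A) (algpoint B A') _
  point_comp point_comp_linear.

End PointComposition.

(** * Tensor powers represent tuples of points *)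

Section TensorPowers.
Variables (K : fieldType) (B : comAlgType K).

Lemma eq_tpow_prod (A : comAlgType K) n (f g : 'I_n -> B -> A) x :
  (forall i, f i =1 g i) -> tpow_prod f x = tpow_prod g x.
Proof.
move=> fg; congr (tpow_prod _ x); apply/funext => i; exact/funext.
Qed.

Lemma tpow_prodS_pure (A : comAlgType K) n (f : 'I_n.+1 -> B -> A) (x : tpow B n) b :
  (forall i, linear (f i)) ->
  tpow_prod f (x \ox b) =
  tpow_prod (fun i => f (widen_ord (leqnSn n) i)) x * f ord_max b.
Proof.
by move=> lf; apply: copair_pure => //; apply: tpow_prod_linear => i; apply: lf.
Qed.

Lemma tpow_prod_comp (A A' : comAlgType K) (g : {lrmorphism A -> A'}) n
    (f : 'I_n -> B -> A) x :
  (forall i, linear (f i)) -> g (tpow_prod f x) = tpow_prod (fun i => g \o f i) x.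
Proof.
elim: n f x => [|n IHn] f x lf /=; first by rewrite linearZ rmorph1.
rewrite -[tens_lift _ x]/(copair _ _ x) copair_comp.
by apply: eq_tens_lift => y b /=; rewrite IHn.
Qed.

Lemma tpow_prod_monoid_morphism (A : comAlgType K) n (f : 'I_n -> B -> A) :
  (forall i, linear (f i)) -> (forall i, GRing.monoid_morphism (f i)) ->
  GRing.monoid_morphism (tpow_prod f).
Proof.
elim: n f => [|n IHn] f lf mf.
  by split=> [|x y] /=; rewrite ?scale1r // -scalerAl mul1r scalerA.
apply: copair_monoid_morphism => //; first by apply: tpow_prod_linear => i.
by apply: IHn => i.
Qed.

End TensorPowers.

(** * Rows of infinite matrices *)

Section FiniteSums.
Local Open Scope classical_set_scope.

Lemma fsum_ord (V : zmodType) (F : nat -> V) n :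
  (forall j, (n <= j)%N -> F j = 0) -> \sum_(j \in [set: nat]) F j = \sum_(j < n) F j.
Proof.
move=> F0; rewrite fsbig_ord; apply/esym/fsbig_widen => //.
by move=> j [_ /= /negP]; rewrite -leqNgt => /F0.
Qed.

(** The condition i < j excludes the diagonal ones of the identity block, so
    that a single bound n serves all rows. *)
Lemma imx_row_bound (K : fieldType) (M : imx K) :
  exists n, forall i j, (n <= j)%N -> (i < j)%N -> M i j = 0.
Proof.
have /almost_idP[n nP] := imx_almost_id M; exists n => i j nj ij.
by rewrite nP ?(ltn_eqF ij) // [(j < n)%N]ltnNge nj andbF.
Qed.

End FiniteSums.

(** * The limit of the tensor powers as a free object on points *)

Section Limit.
Variables (K : fieldType) (B : scaledBialgebra K).

Local Notation L := (tpow_ascAlg B).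
Local Notation H := (dirlim L).

Section Lift.
Variables (A : comAlgType K) (s : nat -> algpoint B A).

Definition dirlim_lift (x : H) : A :=
  tpow_prod (fun i : 'I_(tag (repr x)) => s i) (tagged (repr x)).

(** The embedding of B_n into B_(n+1) inserts 1, on which the new point takes
    the value 1; so the maps on the B_n determined by a sequence of points are
    compatible. *)
Lemma tpow_prod_asc_to n (x : L n) m : (n <= m)%N ->
  tpow_prod (fun i : 'I_m => s i) (asc_to x m) = tpow_prod (fun i : 'I_n => s i) x.
Proof.
move=> /subnK <-; elim: (m - n)%N => [|d IHd]; first by rewrite asc_to_id.
rewrite addSn asc_toS ?leq_addl // -IHd.
rewrite [LHS]tpow_prodS_pure ?rmorph1 ?mulr1 // => i; exact: point_linear.
Qed.

Lemma dirlim_lift_in n (x : L n) :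
  dirlim_lift (dirlim_in L x) = tpow_prod (fun i : 'I_n => s i) x.
Proof.
have mk := leq_maxl (tag (repr (dirlim_in L x))) n.
have nk := leq_maxr (tag (repr (dirlim_in L x))) n.
by rewrite /dirlim_lift -(tpow_prod_asc_to _ mk) dirlim_repr // tpow_prod_asc_to.
Qed.

Let slin i : linear (s i). Proof. exact: point_linear. Qed.

Let dirlim_lift_linear : linear dirlim_lift.
Proof.
move=> a x y; have [n [u [v [-> ->]]]] := dirlim_in_surj2 x y.
rewrite -linearP !dirlim_lift_in tpow_prod_linear //.
Qed.

Let dirlim_lift_monoid_morphism : GRing.monoid_morphism dirlim_lift.
Proof.
have mlift n : GRing.monoid_morphism (tpow_prod (fun i : 'I_n => s i)).
  by apply: tpow_prod_monoid_morphism => // i; apply: point_monoid_morphism.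
split=> [|x y].
  by rewrite -[1]/(dirlim_in L (1 : L 0)) dirlim_lift_in; have [] := mlift 0%N.
have [n [u [v [-> ->]]]] := dirlim_in_surj2 x y.
by rewrite -rmorphM !dirlim_lift_in; have [_ ->] := mlift n.
Qed.

HB.instance Definition _ :=
  GRing.isLinear.Build K H A _ dirlim_lift dirlim_lift_linear.
HB.instance Definition _ :=
  GRing.isMonoidMorphism.Build H A dirlim_lift dirlim_lift_monoid_morphism.

End Lift.

(** Together with [dirlim_lift_generic] this describes composition of algebra
    endomorphisms of H in terms of the corresponding sequences of points. *)
Lemma dirlim_lift_comp (A A' : comAlgType K) (g : {lrmorphism A -> A'})
    (s : nat -> algpoint B A) x :
  g (dirlim_lift s x) = dirlim_lift (fun k => point_comp g (s k)) x.
Proof.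
have [n [u ->]] := dirlim_in_surj x.
by rewrite !dirlim_lift_in tpow_prod_comp // => i; apply: point_linear.
Qed.

Lemma generic_linear k : linear (fun b : B => dirlim_in L ((1 : tpow B k) \ox b : L k.+1)).
Proof.
by move=> a x y; rewrite -linearP; congr dirlim_in; apply: (tens_pure_bilinear _ _).2.
Qed.

Lemma generic_monoid_morphism k :
  GRing.monoid_morphism (fun b : B => dirlim_in L ((1 : tpow B k) \ox b : L k.+1)).
Proof.
split=> [|x y]; first by rewrite tens_pure1 rmorph1.
by rewrite -rmorphM; congr dirlim_in; rewrite tens_pureM mulr1.
Qed.

(** The k-th coordinate on H, with tensor factors counted from 0: the insertion
    of B as the last factor of B_(k+1). *)
Definition generic (k : nat) : algpoint B H :=
  AlgPoint (generic_linear k) (generic_monoid_morphism k).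

Lemma dirlim_in_pure n (x : L n) b :
  dirlim_in L (x \ox b : L n.+1) = dirlim_in L x * generic n b.
Proof.
have iM m (y z : L m) : dirlim_in L (y * z) = dirlim_in L y * dirlim_in L z.
  exact: rmorphM.
rewrite -(dirlim_in_incl (F := L) x).
rewrite -[RHS]/(_ * dirlim_in L ((1 : tpow B n) \ox b : L n.+1)) -iM.
by congr dirlim_in; rewrite tens_pureM mulr1 mul1r.
Qed.

(** On pure tensors this says that b_0 (x) ... (x) b_(n-1) is the product of the
    values xi_i(b_i), so the first n coordinates generate B_n. *)
Lemma dirlim_in_generic n (x : L n) :
  dirlim_in L x = tpow_prod (fun i : 'I_n => generic i) x.
Proof.
have glin k : linear (generic k) by apply: point_linear.
elim: n x => [|n IHn] x.
  rewrite /= -[RHS]/((x : K) *: dirlim_in L (1 : L 0)) -linearZ.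
  by congr dirlim_in; rewrite /= [_ *: _]mulr1.
apply: (@tens_lift_unique K (tpow B n) B H (fun y => dirlim_in L (y : L n.+1))).
- exact: (linearP (dirlim_in L (n := n.+1))).
- by apply: (@tpow_prod_linear _ _ _ n.+1) => i; apply: glin.
by move=> y b; rewrite tpow_prodS_pure // -IHn dirlim_in_pure.
Qed.

Lemma dirlim_lift_generic x : dirlim_lift generic x = x.
Proof.
by have [n [u ->]] := dirlim_in_surj x; rewrite dirlim_lift_in dirlim_in_generic.
Qed.

Lemma dirlim_lift_generic_point (A : comAlgType K) (s : nat -> algpoint B A) k :
  point_comp (dirlim_lift s) (generic k) = s k.
Proof.
apply: pointP => b; rewrite /= dirlim_lift_in.
rewrite tpow_prodS_pure; last by move=> i; apply: point_linear.
have [-> _] : GRing.monoid_morphism (tpow_prod (fun i : 'I_k => s i)).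
  by apply: tpow_prod_monoid_morphism => i; [apply: point_linear | apply: point_monoid_morphism].
by rewrite mul1r.
Qed.

(** The iterated coproduct followed by the scalings is, by definition, an
    iterated convolution of scaled insertions: a^* is the linear combination of
    the coordinates with coefficients a. *)
Lemma dirlim_in_row_star n (a : 'rV[K]_n) b :
  dirlim_in L (row_star a b : L n) = (\sum_(i < n) a 0 i *: generic i) b.
Proof.
have slin c : linear (scaling B c) by apply: linearP.
(* The entries of the row are abstracted so that the induction can drop the last. *)
suff key (c : 'I_n -> K) x : dirlim_in L (tpow_map (fun i => scaling B (c i)) (itcomul n x) : L n)
    = (\sum_(i < n) c i *: generic i) x by apply: key.
elim: n c x {a b} => [|n IHn] c x.
  rewrite big_ord0 point_zeroE -[RHS]/(_ *: dirlim_in L (1 : L 0)) -linearZ.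
  by congr dirlim_in; rewrite /= [_ *: _]mulr1.
rewrite big_ord_recr point_addE /=.
rewrite tens_map_comp //; last by apply: tpow_map_linear.
rewrite /tens_map tens_lift_comp; last exact: (linearP (dirlim_in L (n := n.+1))).
by apply: eq_tens_lift => y z; rewrite dirlim_in_pure /= IHn.
Qed.

Lemma row_star_linear n (a : 'rV[K]_n) : linear (row_star a : B -> tpow B n).
Proof.
have itlin m : linear (@itcomul K B m).
  elim: m => [|m IHm] c x y /=; first exact: linearP.
  by rewrite linearP tens_map_linear.
move=> c x y; rewrite /row_star itlin tpow_map_linear // => i.
exact: linearP.
Qed.

(** * Matrices acting on sequences of points *)

Section Rows.
Local Open Scope classical_set_scope.

(** The image of the i-th coordinate under M^*. The sum runs over all of nat, in
    the same way as the entries of a product of infinite matrices. *)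
Definition row_point (M : imx K) (i : nat) : algpoint B H :=
  \sum_(j \in [set: nat]) M i j *: generic j.

Lemma row_pointE (M : imx K) i n : (forall j, (n <= j)%N -> M i j = 0) ->
  row_point M i = \sum_(j < n) M i j *: generic j.
Proof. by move=> M0; apply: fsum_ord => j nj; rewrite M0 // scale0r. Qed.

Lemma row_point_delta (M : imx K) i (c : K) :
  (forall j, M i j = c * (i == j)%:R) -> row_point M i = c *: generic i.
Proof.
move=> Mi; rewrite (@row_pointE _ _ i.+1) => [|j ij].
  rewrite (bigD1 ord_max) //= big1 ?addr0 ?Mi ?eqxx ?mulr1 // => j ji.
  by rewrite -val_eqE /= eq_sym in ji; rewrite Mi (negPf ji) mulr0 scale0r.
by rewrite Mi ltn_eqF ?mulr0.
Qed.

(** Writing the rows of M N as combinations of the rows of N is what makes the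
    action contravariant. *)
Lemma row_point_mul (M N : imx K) i :
  row_point (imx_mul M N) i = \sum_(j \in [set: nat]) M i j *: row_point N j.
Proof.
have [m mP] := imx_row_bound M; have [n nP] := imx_row_bound N.
(* Row i of M and the rows h < k of N are supported in the columns below k, so
   all the sums involved are sums over h, j < k. *)
pose k := maxn i.+1 (maxn m n).
have Mk j : (k <= j)%N -> M i j = 0.
  by rewrite !geq_max => /and3P[ij mj _]; apply: mP.
have Nk h j : (h < k)%N -> (k <= j)%N -> N h j = 0.
  by move=> hk kj; move: (kj); rewrite !geq_max => /and3P[_ _ nj];
    apply: nP => //; apply: leq_trans kj.
have MNE j : imx_mul M N i j = \sum_(h < k) M i h * N h j.
  by apply: fsum_ord => h kh; rewrite Mk ?mul0r.
rewrite (@row_pointE _ _ k) => [|j kj]; last first.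
  by rewrite MNE big1 // => h _; rewrite Nk ?mulr0.
rewrite [RHS](@fsum_ord _ _ k) => [|j kj]; last by rewrite Mk ?scale0r.
under eq_bigr => j _ do rewrite MNE scaler_suml.
rewrite exchange_big; apply: eq_bigr => h _ /=.
rewrite (@row_pointE N h k) => [|j]; last exact: Nk.
by rewrite scaler_sumr; apply: eq_bigr => j _; rewrite scalerA.
Qed.

Lemma imx_of_mxE n (M : 'M[K]_n) (i j : 'I_n) : imx_of_mx M i j = M i j.
Proof. by rewrite /= !valK. Qed.

(** Enlarging the finite block beyond any given m lets a matrix and an element
    of H be treated at the same level. *)
Lemma imx_of_mx_surj (M : imx K) m :
  exists n (M' : 'M[K]_n), (m <= n)%N /\ imx_of_mx M' = M.
Proof.
have /almost_idP[k kP] := imx_almost_id M.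
exists (maxn m k), (\matrix_(i, j) M i j); split; first exact: leq_maxl.
apply: imxP => i j /=; case: insubP => [i' _ <-|nj]; last first.
  rewrite kP // negb_and; apply/orP; left; apply: contra nj => ik.
  by apply: leq_trans ik (leq_maxr _ _).
case: insubP => [j' _ <-|nj]; first by rewrite mxE.
rewrite kP // negb_and; apply/orP; right; apply: contra nj => ik.
by apply: leq_trans ik (leq_maxr _ _).
Qed.

Lemma row_point_of_mx n (M : 'M[K]_n) (i : 'I_n) :
  row_point (imx_of_mx M) i = \sum_(j < n) M i j *: generic j.
Proof.
rewrite (@row_pointE _ _ n) => [|j nj].
  by apply: eq_bigr => j _; rewrite imx_of_mxE.
rewrite /= valK insubF; last by rewrite ltnNge nj.
by rewrite ltn_eqF // (leq_trans (ltn_ord i)).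
Qed.

(** Defining the action on H by substitution treats all levels at once, so that
    no choice of a level n has to be shown irrelevant. *)
Definition matrix_action (M : imx K) : H -> H := dirlim_lift (row_point M).

HB.instance Definition _ M := GRing.LRMorphism.on (matrix_action M).

Lemma matrix_action_in n (M : imx K) (x : L n) :
  matrix_action M (dirlim_in L x) = tpow_prod (fun i : 'I_n => row_point M i) x.
Proof. exact: dirlim_lift_in. Qed.

Lemma matrix_action_induced : is_induced_action matrix_action.
Proof.
move=> n M x; rewrite matrix_action_in /mx_star.
have := @tpow_prod_comp K B (L n) H (dirlim_in L (n := n)) n
  (fun i => row_star (row i M)) x => -> /=; last by move=> i; apply: row_star_linear.
apply: eq_tpow_prod => i b; rewrite row_point_of_mx /= dirlim_in_row_star.
by congr (point_fun _ b); apply: eq_bigr => j _; rewrite mxE.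
Qed.

Lemma induced_action_unique act : is_induced_action (B := B) act -> act = matrix_action.
Proof.
move=> actP; apply/funext => M; apply/funext => x.
have [m [u ->]] := dirlim_in_surj x.
have [n [M' [mn <-]]] := imx_of_mx_surj M m.
by rewrite -(dirlim_in_to u mn) actP matrix_action_induced.
Qed.

Lemma matrix_action1 x : matrix_action (imx_one K) x = x.
Proof.
rewrite -[RHS]dirlim_lift_generic; congr (dirlim_lift _ x); apply/funext => i.
by rewrite (@row_point_delta _ i 1) ?scale1r // => j; rewrite mul1r.
Qed.

Lemma matrix_actionM M N x :
  matrix_action (imx_mul M N) x = matrix_action N (matrix_action M x).
Proof.
rewrite [in RHS]/(matrix_action M) dirlim_lift_comp.
congr (dirlim_lift _ x); apply/funext => i; rewrite row_point_mul.
have [m mP] := imx_row_bound M; pose k := maxn i.+1 m.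
have Mk j : (k <= j)%N -> M i j = 0.
  by rewrite !geq_max => /andP[ij mj]; apply: mP.
rewrite (@fsum_ord _ _ k) => [|j kj]; last by rewrite Mk ?scale0r.
rewrite (row_pointE Mk) linear_sum; apply: eq_bigr => j _.
by rewrite linearZ /= dirlim_lift_generic_point.
Qed.

Lemma matrix_action_cut n M x : stage L n x ->
  matrix_action M x = matrix_action (imx_cut n M) x.
Proof.
move=> [u _ <-]; rewrite !matrix_action_in; apply: eq_tpow_prod => i b.
by congr (point_fun _ b); apply: eq_fsbigr => j _; rewrite /= ltn_ord.
Qed.

(** The last coordinate of B_(n+1) is replaced by the zero point, and
    x (x) b goes to counit(b) x. *)
Lemma matrix_action_E n x : stage L n.+1 x -> stage L n (matrix_action (imx_E K n) x).
Proof.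
move=> [u _ <-]; elim/tens_ind: u => [|u v [y _ yE] [z _ zE]|u b].
- by exists 0; rewrite ?linear0.
- by exists (y + z); rewrite // !linearD /= yE zE.
rewrite matrix_action_in.
rewrite tpow_prodS_pure; last by move=> i; apply: point_linear.
rewrite [row_point _ ord_max](@row_point_delta _ _ 0) => [|j]; last first.
  by rewrite /= eqxx eq_sym /= subrr mul0r.
rewrite scale0r point_zeroE.
exists (counit B b *: u) => //; rewrite linearZ /= dirlim_in_generic.
rewrite -scalerAr mulr1; congr (_ *: _); apply: eq_tpow_prod => i c.
rewrite (@row_point_delta _ _ 1) ?scale1r // => j.
by rewrite /= mul1r (ltn_eqF (ltn_ord i)) subr0.
Qed.

End Rows.
End Limit.

Theorem proposition3p3 (K : fieldType) (K0 : [pchar K] =i pred0)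
    (B : scaledBialgebra K) :
  (exists! act, is_induced_action (B := B) act) /\
  (forall act, is_induced_action (B := B) act -> K_hierarchy act).
Proof.
split.
  exists (@matrix_action K B); split; first exact: matrix_action_induced.
  by move=> act /induced_action_unique.
move=> act actP; move: (actP); rewrite (induced_action_unique actP) => mP.
split.
- by move=> M; apply: linearP.
- by move=> M; split; [apply: rmorph1 | apply: rmorphM].
- exact: matrix_action1.
- exact: matrix_actionM.
- by move=> n M x; apply: matrix_action_cut.
- by move=> n M _ [u _ <-]; exists (mx_star M u); rewrite ?mP.
- exact: matrix_action_E.
Qed.
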